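(* Let $n\le 4$ and let $\mathbf v_1,\dots,\mathbf v_n$ be vectors in a Euclidean space (a finite-dimensional real inner product space) such that $\langle \mathbf v_k,\mathbf v_l\rangle\ge 0$ for all $k,l=1,\dots,n$. Then there exist positive semidefinite matrices $A_1,\dots,A_n\in M_4(\mathbb C)$ such that $\frac14\mathrm{Tr}(A_kA_l)=\langle \mathbf v_k,\mathbf v_l\rangle$ for all $k,l=1,\dots,n$.
   Context: $M_d(\mathbb C)$ denotes the algebra of $d\times d$ complex matrices. The real vector space of self-adjoint elements of $M_d(\mathbb C)$ carries the inner product $\langle A,B\rangle=\frac1d\mathrm{Tr}(AB)$. *)

(* Defs.v *)
From HB Require Import structures.
From mathcomp Require Import all_boot all_order all_algebra.
From mathcomp Require Import reals complex.

Set Implicit Arguments.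
Unset Strict Implicit.
Unset Printing Implicit Defensive.

Import GRing.Theory Num.Theory.
Local Open Scope ring_scope.
Local Open Scope sesquilinear_scope.

(* In the partial order of [C], [0 <= z] says that [z] is real and
   nonnegative. *)
Definition psdmx (C : numClosedFieldType) (d : nat) (A : 'M[C]_d) : Prop :=
  A \is hermsymmx /\ forall x : 'cV[C]_d, 0 <= (x ^t* *m A *m x) 0 0.

(* Main.v *)
Require Import Defs.
From HB Require Import structures.
From mathcomp Require Import all_boot all_order all_algebra.
From mathcomp Require Import reals complex.
From mathcomp Require Import ring lra.

Set Implicit Arguments.
Unset Strict Implicit.
Unset Printing Implicit Defensive.

Import Order.TTheory GRing.Theory Num.Theory.
Local Open Scope ring_scope.
Local Open Scope complex_scope.

(** It suffices to embed the vectors isometrically into the nonnegative orthant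
of R^4 and to take A_k = 2 diag(v_k).

Replacing v_i by v_i - c v_j with c >= 0 is harmless: an embedding of the new
family gives one of the old family, since v_i is a nonnegative combination of
the new vectors.  If i ~ j and every neighbour of j other than i is one of i, in
the graph of nonzero products, the largest c keeping all products nonnegative
is positive and the graph loses an edge.  On four vertices the only graphs
allowing no such step are the empty graph (orthogonal vectors) and the
4-cycle.  For the 4-cycle one looks for an embedding
  v_1 = (a,b,0,0), v_2 = (0,0,c,d), v_3 = (x,0,y,0), v_4 = (0,z,0,w);
once a^2 = s is chosen, all equations but d w = <v_2,v_4> determine the
remaining entries, and the last one is solved by the intermediate value
theorem. *)

(** * The equations of the 4-cycle over a real closed field *)

Lemma sqrtrM_div (R : rcfType) (t a : R) :
  0 < t -> 0 <= a -> Num.sqrt t * Num.sqrt (a ^+ 2 / t) = a.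
Proof.
move=> t0 a0; rewrite -sqrtrM ?ltW // mulrCA mulfV ?gt_eqF // mulr1.
by rewrite sqrtr_sqr ger0_norm.
Qed.

(* The starting point of the deformation: with a^2 = al (al + ga rho) / g3 and
   v_1, v_3, v_4 of the prescribed norms, v_2 has norm at most that prescribed. *)
Lemma cycle_parameter (R : realFieldType) (g1 g2 g3 g4 al be ga de : R) :
  0 < g3 -> 0 < g4 -> 0 < al -> 0 < be -> 0 < ga -> 0 < de ->
  (forall u1 u2 w1 w2, 0 <= g1 * u1 ^+ 2 + g2 * u2 ^+ 2 + g3 * w1 ^+ 2 +
    g4 * w2 ^+ 2 - 2 * (al * u1 * w1 + be * u1 * w2 + ga * u2 * w1 +
    de * u2 * w2)) ->
  exists2 rho, 0 < rho &
    g1 = al * (al + ga * rho) / g3 + be * (be + de * rho) / g4 /\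
    ga * (al + ga * rho) / g3 + de * (be + de * rho) / g4 <= g2 * rho.
Proof.
move=> g3p g4p alp bep gap dep psd.
set p := al ^+ 2 / g3 + be ^+ 2 / g4.
set q := al * ga / g3 + be * de / g4.
set r := ga ^+ 2 / g3 + de ^+ 2 / g4.
have q0 : 0 < q by rewrite addr_gt0 // divr_gt0 // mulr_gt0.
have g3n : g3 != 0 by rewrite gt_eqF.
have g4n : g4 != 0 by rewrite gt_eqF.
(* Minimising over [w1], [w2] leaves the Schur complement, a positive semidefinite binary form. *)
have form u1 u2 : 0 <= (g1 - p) * u1 ^+ 2 - 2 * q * u1 * u2 + (g2 - r) * u2 ^+ 2.
  have := psd u1 u2 ((al * u1 + ga * u2) / g3) ((be * u1 + de * u2) / g4).
  by congr (0 <= _); rewrite /p /q /r; field; rewrite g3n g4n.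
have p0 : 0 <= g1 - p by have := form 1 0; rewrite !expr2; lra.
have p1 : 0 < g1 - p.
  rewrite lt_def p0 andbT; apply/eqP => e.
  (* If [g1 = p], the form is affine in [u1] at [u2 = 1]; this [u1] gives it the value -1. *)
  have := form ((g2 - r + 1) / (2 * q)) 1; rewrite e mul0r.
  rewrite [2 * q * _]mulrC divfK ?mulf_neq0 ?gt_eqF ?pnatr_eq0 //; lra.
have D : q ^+ 2 <= (g1 - p) * (g2 - r).
  have := form q (g1 - p).
  have -> : (g1 - p) * q ^+ 2 - 2 * q * q * (g1 - p) + (g2 - r) * (g1 - p) ^+ 2
    = (g1 - p) * ((g1 - p) * (g2 - r) - q ^+ 2) by ring.
  by rewrite pmulr_rge0 // subr_ge0.
have qn : q != 0 by rewrite gt_eqF.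
(* The required equality reads [g1 = p + rho * q], which forces [rho]; multiplied by [q], the
   inequality becomes [D]. *)
exists ((g1 - p) / q); first by rewrite divr_gt0.
set rho := (g1 - p) / q.
have rq : rho * q = g1 - p by rewrite divfK.
split.
  have -> : g1 = p + rho * q by rewrite rq; ring.
  by rewrite /p /q; field; rewrite g3n g4n.
have -> : ga * (al + ga * rho) / g3 + de * (be + de * rho) / g4 = q + r * rho.
  by rewrite /q /r; field; rewrite g3n g4n.
rewrite -(ler_pM2r q0).
have -> : (q + r * rho) * q = q ^+ 2 + r * (rho * q) by ring.
have -> : g2 * rho * q = g2 * (rho * q) by ring.
by rewrite rq; move: D; lra.
Qed.

(** The intermediate value theorem in s = a^2 applies between [s0], where d^2 w^2 >= de^2, and [s1],
    where w = 0. The [g]'s are the squared norms of v_1, ..., v_4, and [al], [be], [ga], [de] are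
    the products v_1 v_3, v_1 v_4, v_2 v_3, v_2 v_4. *)
Lemma cycle_embedding (R : rcfType) (g1 g2 g3 g4 al be ga de : R) :
  0 < g3 -> 0 < g4 -> 0 < al -> 0 < be -> 0 < ga -> 0 < de ->
  (forall u1 u2 w1 w2, 0 <= g1 * u1 ^+ 2 + g2 * u2 ^+ 2 + g3 * w1 ^+ 2 +
    g4 * w2 ^+ 2 - 2 * (al * u1 * w1 + be * u1 * w2 + ga * u2 * w1 +
    de * u2 * w2)) ->
  exists a b c d x y z w : R,
    [/\ 0 <= a /\ 0 <= b, 0 <= c /\ 0 <= d, 0 <= x /\ 0 <= y & 0 <= z /\ 0 <= w]
    /\ [/\ a ^+ 2 + b ^+ 2 = g1, c ^+ 2 + d ^+ 2 = g2, x ^+ 2 + y ^+ 2 = g3 &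
           z ^+ 2 + w ^+ 2 = g4]
    /\ [/\ a * x = al, b * z = be, c * y = ga & d * w = de].
Proof.
move=> g3p g4p alp bep gap dep psd.
have [rho rhop [g1E g2ge]] := cycle_parameter g3p g4p alp bep gap dep psd.
have g3n : g3 != 0 by rewrite gt_eqF.
have g4n : g4 != 0 by rewrite gt_eqF.
(* With s = a^2: P = s y^2, Q = b^2, and F / (P Q) = de^2 - d^2 w^2.  At s1 the
   entry w vanishes. *)
pose P := g3%:P * 'X - (al ^+ 2)%:P : {poly R}.
pose Q := g1%:P - 'X : {poly R}.
pose F := (de ^+ 2)%:P * P * Q -
  (g2%:P * P - (ga ^+ 2)%:P * 'X) * (g4%:P * Q - (be ^+ 2)%:P).
have FE s : F.[s] = de ^+ 2 * (g3 * s - al ^+ 2) * (g1 - s) -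
    (g2 * (g3 * s - al ^+ 2) - ga ^+ 2 * s) * (g4 * (g1 - s) - be ^+ 2).
  by rewrite /F /P /Q !hornerE.
pose s0 := al * (al + ga * rho) / g3.
pose s1 := g1 - be ^+ 2 / g4.
have algr : 0 < al + ga * rho by rewrite addr_gt0 // mulr_gt0.
have bedr : 0 < be + de * rho by rewrite addr_gt0 // mulr_gt0.
have s0p : 0 < s0 by rewrite divr_gt0 // mulr_gt0.
have P0 : g3 * s0 - al ^+ 2 = al * ga * rho by rewrite /s0; field.
have Q0 : g1 - s0 = be * (be + de * rho) / g4 by rewrite g1E /s0; ring.
have Q0' : g4 * (g1 - s0) - be ^+ 2 = be * de * rho by rewrite Q0; field.
have P0' : g2 * (g3 * s0 - al ^+ 2) - ga ^+ 2 * s0 =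
    al * ga * (g2 * rho - ga * (al + ga * rho) / g3).
  by rewrite P0 /s0; field.
have det_ge : de * (be + de * rho) / g4 <=
    g2 * rho - ga * (al + ga * rho) / g3 by move: g2ge; lra.
have det_ge0 : 0 <= g2 * rho - ga * (al + ga * rho) / g3.
  by apply: le_trans det_ge; rewrite ltW // divr_gt0 // mulr_gt0.
(* Cauchy-Schwarz for v_2 and v_3. It makes the numerator of d^2 nondecreasing in s, so
   nonnegativity at [s0] passes to the root. *)
have g23 : 0 <= g2 * g3 - ga ^+ 2.
  suff : 0 <= (g2 * g3 - ga ^+ 2) * (rho / g3) by rewrite pmulr_lge0 // divr_gt0.
  have -> : (g2 * g3 - ga ^+ 2) * (rho / g3) =
    g2 * rho - ga * (al + ga * rho) / g3 + ga * al / g3 by field.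
  by rewrite addr_ge0 // ltW // divr_gt0 // mulr_gt0.
have s01 : s0 <= s1.
  rewrite /s1 lerBrDr -lerBrDl Q0 expr2 ler_pM2r ?invr_gt0 // ler_pM2l //.
  by rewrite lerDl ltW // mulr_gt0.
(* At [s0], w^2 = de rho g4 / (be + de rho), and [det_ge] bounds rho d^2 from below, whence d^2 w^2
   >= de^2. *)
have F0 : F.[s0] <= 0.
  rewrite FE P0' P0 Q0' Q0.
  have -> : de ^+ 2 * (al * ga * rho) * (be * (be + de * rho) / g4) -
     al * ga * (g2 * rho - ga * (al + ga * rho) / g3) * (be * de * rho) =
     al * be * ga * de * rho * (de * (be + de * rho) / g4 -
     (g2 * rho - ga * (al + ga * rho) / g3)) by field; rewrite g3n g4n.
  by rewrite pmulr_rle0 ?subr_le0 // !mulr_gt0.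
have F1 : 0 <= F.[s1].
  have Q1 : g1 - s1 = be ^+ 2 / g4 by rewrite /s1; ring.
  have Q1' : g4 * (g1 - s1) - be ^+ 2 = 0 by rewrite Q1; field.
  rewrite FE Q1' mulr0 subr0 Q1 !mulr_ge0 ?(ltW dep) ?(ltW bep) ?invr_ge0 ?(ltW g4p) //.
  apply: (@le_trans _ _ (g3 * s0 - al ^+ 2)).
    by rewrite P0 ltW // !mulr_gt0.
  by rewrite lerD2r ler_pM2l.
have F01 : F.[s0] <= 0 <= F.[s1] by rewrite F0 F1.
have [s /andP[ss0 ss1]] := poly_ivt s01 F01.
rewrite rootE FE subr_eq0 => /eqP Fs.
(* All radicands are nonnegative at the root: those of y and d because s >= [s0], those of b and w
   because s <= [s1]. *)
have sp : 0 < s by apply: lt_le_trans ss0.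
have Ps : 0 < g3 * s - al ^+ 2.
  apply: (@lt_le_trans _ _ (g3 * s0 - al ^+ 2)); first by rewrite P0 !mulr_gt0.
  by rewrite lerD2r ler_pM2l.
have Qs : be ^+ 2 <= g4 * (g1 - s).
  by rewrite -ler_pdivrMl // mulrC; move: ss1; rewrite /s1; lra.
have Qp : 0 < g1 - s.
  by rewrite -(pmulr_rgt0 _ g4p); apply: lt_le_trans Qs; rewrite exprn_gt0.
have Ps' : 0 <= g2 * (g3 * s - al ^+ 2) - ga ^+ 2 * s.
  apply: (@le_trans _ _ (g2 * (g3 * s0 - al ^+ 2) - ga ^+ 2 * s0)).
    by rewrite P0' mulr_ge0 // ltW // mulr_gt0.
  rewrite -subr_ge0.
  have -> : g2 * (g3 * s - al ^+ 2) - ga ^+ 2 * s -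
    (g2 * (g3 * s0 - al ^+ 2) - ga ^+ 2 * s0) =
    (g2 * g3 - ga ^+ 2) * (s - s0) by ring.
  by rewrite mulr_ge0 // subr_ge0.
have sn : s != 0 by rewrite gt_eqF.
have Pn : g3 * s - al ^+ 2 != 0 by rewrite gt_eqF.
have Qn : g1 - s != 0 by rewrite gt_eqF.
have y2p : 0 < (g3 * s - al ^+ 2) / s by rewrite divr_gt0.
have x2p : 0 <= al ^+ 2 / s by rewrite divr_ge0 ?sqr_ge0 ?ltW.
have z2p : 0 <= be ^+ 2 / (g1 - s) by rewrite divr_ge0 ?sqr_ge0 ?ltW.
have c2p : 0 <= ga ^+ 2 / ((g3 * s - al ^+ 2) / s).
  by rewrite divr_ge0 ?sqr_ge0 ?ltW.
pose d2 := (g2 * (g3 * s - al ^+ 2) - ga ^+ 2 * s) / (g3 * s - al ^+ 2).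
pose w2 := (g4 * (g1 - s) - be ^+ 2) / (g1 - s).
have d2p : 0 <= d2 by rewrite divr_ge0 // ltW.
have w2p : 0 <= w2 by rewrite /w2; apply: divr_ge0; [rewrite subr_ge0 | apply: ltW].
exists (Num.sqrt s), (Num.sqrt (g1 - s)),
  (Num.sqrt (ga ^+ 2 / ((g3 * s - al ^+ 2) / s))), (Num.sqrt d2),
  (Num.sqrt (al ^+ 2 / s)), (Num.sqrt ((g3 * s - al ^+ 2) / s)),
  (Num.sqrt (be ^+ 2 / (g1 - s))), (Num.sqrt w2).
split; first by rewrite !sqrtr_ge0.
split.
  rewrite !sqr_sqrtr ?(ltW sp) ?(ltW Qp) ?(ltW y2p) //; split.
  - by ring.
  - by rewrite /d2; field; rewrite sn Pn.
  - by field.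
  - by rewrite /w2; field.
split.
- by rewrite sqrtrM_div // ltW.
- by rewrite sqrtrM_div // ltW.
- by rewrite mulrC sqrtrM_div // ltW.
rewrite -sqrtrM //.
have -> : d2 * w2 = de ^+ 2.
  by rewrite /d2 /w2 mulrACA -Fs; field; rewrite Pn Qn.
by rewrite sqrtr_sqr gtr0_norm.
Qed.

(** * Inner products and embeddings into the nonnegative orthant *)

Lemma dotC (R : rcfType) (E : lmodType R) (dot : {dot E for @idfun R}) u v :
  dot u v = dot v u.
Proof. by rewrite hermC /= expr0 mul1r. Qed.

Lemma dot_ge0 (R : rcfType) (E : lmodType R) (dot : {dot E for @idfun R}) u :
  0 <= dot u u.
Proof.
by have [->|/(neq0_dnorm_gt0 (s := dot))/ltW//] := eqVneq u 0; rewrite linear0r.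
Qed.

Lemma dotDZl (R : rcfType) (E : lmodType R) (dot : {dot E for @idfun R}) u v w a :
  dot (u + a *: v) w = dot u w + a * dot v w.
Proof. by rewrite linearDl linearZl_LR. Qed.

Lemma dotDZr (R : rcfType) (E : lmodType R) (dot : {dot E for @idfun R}) u v w a :
  dot w (u + a *: v) = dot w u + a * dot w v.
Proof. by rewrite !(dotC dot w) dotDZl. Qed.

Lemma dot_neq0 (R : rcfType) (E : lmodType R) (dot : {dot E for @idfun R}) u v :
  dot u v != 0 -> dot v v != 0.
Proof.
move=> uv; apply: lt0r_neq0; apply: neq0_dnorm_gt0.
by apply: contraNneq uv => ->; rewrite linear0r.
Qed.

(** Equivalently, the Gram matrix of [v] is completely positive, with a square nonnegative
    factor. *)
Definition orthant_embeddable (R : rcfType) (E : lmodType R)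
    (dot : {dot E for @idfun R}) (n : nat) (v : 'I_n -> E) : Prop :=
  exists B : 'I_n -> 'rV[R]_n, (forall k m, 0 <= B k 0 m) /\
    forall k l, dot (v k) (v l) = \sum_m B k 0 m * B l 0 m.

Definition shear (R : rcfType) (E : lmodType R) (n : nat) (v : 'I_n -> E)
    (i j : 'I_n) (c : R) (k : 'I_n) : E :=
  if k == i then v i - c *: v j else v k.

Lemma orthant_embeddable_shear (R : rcfType) (E : lmodType R)
    (dot : {dot E for @idfun R}) (n : nat) (v : 'I_n -> E) i j c :
  i != j -> 0 <= c -> orthant_embeddable dot (shear v i j c) ->
  orthant_embeddable dot v.
Proof.
move=> ij c0 [B [B0 BE]]; set v' := shear v i j c in BE.
(* With [d], one formula recovers every [v k] from the sheared family, in which [v j] is unchanged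
   because i != j. *)
pose d k : R := if k == i then c else 0.
have d0 k : 0 <= d k by rewrite /d; case: ifP.
have vE k : v k = v' k + d k *: v' j.
  rewrite /v' /shear /d [j == i]eq_sym (negPf ij).
  by have [->|] := eqVneq k i; rewrite ?subrK // scale0r addr0.
exists (fun k => B k + d k *: B j); split=> [k m|k l].
  by rewrite !mxE addr_ge0 // mulr_ge0.
rewrite !vE !(dotDZl, dotDZr) !BE !mulr_sumr -!big_split mulr_sumr -big_split /=.
by apply: eq_bigr => m _; rewrite !mxE; ring.
Qed.

Lemma dot_shearl (R : rcfType) (E : lmodType R)
    (dot : {dot E for @idfun R}) (n : nat) (v : 'I_n -> E) i j c l :
  l != i -> dot (shear v i j c i) (shear v i j c l) =
  dot (v i) (v l) - c * dot (v j) (v l).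
Proof. by move=> li; rewrite /shear eqxx (negPf li) -scaleNr dotDZl mulNr. Qed.

Lemma orthogonal_embeddable (R : rcfType) (E : lmodType R)
    (dot : {dot E for @idfun R}) (n : nat) (v : 'I_n -> E) :
  (forall k l, k != l -> dot (v k) (v l) = 0) -> orthant_embeddable dot v.
Proof.
move=> ov; exists (fun k => Num.sqrt (dot (v k) (v k)) *: delta_mx 0 k).
split=> [k m|k l]; first by rewrite !mxE eqxx mulr_ge0 ?sqrtr_ge0 ?ler0n.
rewrite (bigD1 k) //= big1 => [|m mk]; rewrite !mxE !eqxx /=; last first.
  by rewrite (negPf mk) mulr0 mul0r.
rewrite addr0 mulr1; have [->|kl] := eqVneq k l.
  by rewrite mulr1 -expr2 sqr_sqrtr // dot_ge0.
by rewrite !mulr0 ov.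
Qed.

(** Otherwise [m] would be a fifth element of ['I_4]. *)
Lemma ord4_cover (i j k l m : 'I_4) : uniq [:: i; j; k; l] ->
  [\/ m = i, m = j, m = k | m = l].
Proof.
move=> us; have: m \in [:: i; j; k; l].
  apply: contraT => mN.
  have /card_uniqP /= us' : uniq (m :: [:: i; j; k; l]) by rewrite cons_uniq mN.
  by have := max_card (mem [:: m; i; j; k; l]); rewrite us' card_ord.
by rewrite !inE => /or4P[] /eqP; [constructor 1|constructor 2|constructor 3|constructor 4].
Qed.

(** The cycle runs through i, j, k, l, so [v i], [v k], [v j], [v l] play the roles of v_1, v_2,
    v_3, v_4; opposite vertices get disjoint supports. *)
Lemma cycle_embeddable (R : rcfType) (E : lmodType R)
    (dot : {dot E for @idfun R}) (v : 'I_4 -> E) (i j k l : 'I_4) :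
  uniq [:: i; j; k; l] -> dot (v i) (v k) = 0 -> dot (v j) (v l) = 0 ->
  0 < dot (v i) (v j) -> 0 < dot (v i) (v l) ->
  0 < dot (v k) (v j) -> 0 < dot (v k) (v l) ->
  orthant_embeddable dot v.
Proof.
move=> us ik jl ij il kj kl.
have gp u w : 0 < dot u w -> 0 < dot w w.
  by move=> uw; rewrite lt0r dot_ge0 (dot_neq0 (u := u)) // gt_eqF.
have [|a [b [c [d [x [y [z [w]]]]]]]] :=
    @cycle_embedding R (dot (v i) (v i)) (dot (v k) (v k)) _ _ _ _ _ _
      (gp _ _ ij) (gp _ _ il) ij il kj kl.
  move=> u1 u2 w1 w2.
  (* The form is the squared norm of this combination; the minus signs produce its negative cross
     terms, and the leading 0 lets [dotDZl] reach the first summand. *)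
  have := dot_ge0 dot (0 + u1 *: v i + u2 *: v k + (- w1) *: v j + (- w2) *: v l).
  rewrite !(dotDZl, dotDZr) !linear0r !linear0l.
  rewrite (dotC dot (v k) (v i)) (dotC dot (v j)) (dotC dot (v l) (v i)).
  rewrite (dotC dot (v l) (v k)) (dotC dot (v j) (v k)) (dotC dot (v l) (v j)).
  by rewrite ik jl; congr (0 <= _); ring.
move=> [[[a0 b0] [c0 d0] [x0 y0] [z0 w0]] [[ii kk jj ll] [ax bz cy dw]]].
pose row4 (s : seq R) : 'rV[R]_4 := \row_m nth 0 s m.
pose B m := row4 (if m == i then [:: a; b; 0; 0] else
  if m == k then [:: 0; 0; c; d] else
  if m == j then [:: x; 0; y; 0] else [:: 0; z; 0; w]).
move: (us); rewrite /= !inE !negb_or => /and4P[/and3P[nij nik nil] /andP[njk njl] nkl _].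
have Bi : B i = row4 [:: a; b; 0; 0] by rewrite /B eqxx.
have Bk : B k = row4 [:: 0; 0; c; d] by rewrite /B eqxx eq_sym (negPf nik).
have Bj : B j = row4 [:: x; 0; y; 0].
  by rewrite /B eqxx eq_sym (negPf nij) (negPf njk).
have Bl : B l = row4 [:: 0; z; 0; w].
  by rewrite /B !(eq_sym l) (negPf nil) (negPf nkl) (negPf njl).
have sumE s t : \sum_m row4 s 0 m * row4 t 0 m =
    s`_0 * t`_0 + s`_1 * t`_1 + s`_2 * t`_2 + s`_3 * t`_3.
  by rewrite !big_ord_recl big_ord0 !mxE /= addr0 !addrA.
exists B; split=> [m p|m p].
  by case: (ord4_cover m us) => ->; rewrite ?(Bi, Bj, Bk, Bl) mxE;
    case: p => [[|[|[|[|]]]]].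
have sym q r : dot (v q) (v r) = \sum_t B q 0 t * B r 0 t ->
    dot (v r) (v q) = \sum_t B r 0 t * B q 0 t.
  by rewrite dotC => ->; apply: eq_bigr => t _; rewrite mulrC.
have Eii : dot (v i) (v i) = \sum_t B i 0 t * B i 0 t by rewrite Bi sumE /=; lra.
have Ejj : dot (v j) (v j) = \sum_t B j 0 t * B j 0 t by rewrite Bj sumE /=; lra.
have Ekk : dot (v k) (v k) = \sum_t B k 0 t * B k 0 t by rewrite Bk sumE /=; lra.
have Ell : dot (v l) (v l) = \sum_t B l 0 t * B l 0 t by rewrite Bl sumE /=; lra.
have Eij : dot (v i) (v j) = \sum_t B i 0 t * B j 0 t.
  by rewrite Bi Bj sumE /=; lra.
have Eik : dot (v i) (v k) = \sum_t B i 0 t * B k 0 t.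
  by rewrite Bi Bk sumE /=; lra.
have Eil : dot (v i) (v l) = \sum_t B i 0 t * B l 0 t.
  by rewrite Bi Bl sumE /=; lra.
have Ekj : dot (v k) (v j) = \sum_t B k 0 t * B j 0 t.
  by rewrite Bk Bj sumE /=; lra.
have Ejl : dot (v j) (v l) = \sum_t B j 0 t * B l 0 t.
  by rewrite Bj Bl sumE /=; lra.
have Ekl : dot (v k) (v l) = \sum_t B k 0 t * B l 0 t.
  by rewrite Bk Bl sumE /=; lra.
by case: (ord4_cover m us) => ->; case: (ord4_cover p us) => -> //; apply: sym.
Qed.

(** * Induction on the number of nonzero products *)

Lemma acute_embeddable4 (R : rcfType) (E : lmodType R)
    (dot : {dot E for @idfun R}) (v : 'I_4 -> E) :
  (forall k l, 0 <= dot (v k) (v l)) -> orthant_embeddable dot v.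
Proof.
pose edges (v : 'I_4 -> E) :=
  [set p : 'I_4 * 'I_4 | (p.1 != p.2) && (dot (v p.1) (v p.2) != 0)].
have [n] := ubnP #|edges v|; elim: n v => // n IHn v /ltnSE le_n v0.
have gt0 k l : dot (v k) (v l) != 0 -> 0 < dot (v k) (v l).
  by move=> kl; rewrite lt0r kl v0.
case: (pickP [pred p : 'I_4 * 'I_4 | [&& p.1 != p.2, dot (v p.1) (v p.2) != 0 &
    [forall k, (k != p.1) ==> (dot (v p.1) (v k) == 0) ==>
      (dot (v p.2) (v k) == 0)]]]) => [[i j] /=|H].
  case/and3P=> nij gij /forallP zij.
  have zero k : k != i -> dot (v i) (v k) = 0 -> dot (v j) (v k) = 0.
    by move=> ki /eqP gik; have /implyP/(_ ki)/implyP/(_ gik)/eqP := zij k.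
  have Pj : (j != i) && (dot (v j) (v j) != 0).
    by rewrite eq_sym nij (dot_neq0 gij).
  (* The least ratio is the largest admissible c. The index j itself competes, so the product of
     [v i] and [v j] stays nonnegative too. *)
  have [k0 /andP[k0i gjk0] k0min] := arg_minP
    (fun k => dot (v i) (v k) / dot (v j) (v k))
    (P := fun k => (k != i) && (dot (v j) (v k) != 0)) Pj.
  set c := _ / _ in k0min.
  have c0 : 0 <= c by rewrite divr_ge0.
  have cg k : k != i -> 0 <= dot (v i) (v k) - c * dot (v j) (v k).
    move=> ki; have [->|gjk] := eqVneq (dot (v j) (v k)) 0.
      by rewrite mulr0 subr0.
    by rewrite subr_ge0 -ler_pdivlMr ?gt0 // k0min // ki.
  have gik0 : dot (v i) (v k0) != 0 by apply: contraNneq gjk0 => /zero->.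
  apply: (orthant_embeddable_shear nij c0); apply: IHn.
    (* No edge appears, since by [zero] a vanishing product with [v i] stays zero; the edge from i
       to [k0] disappears by the choice of c. *)
    apply: leq_trans le_n; apply: proper_card; apply/properP; split.
      apply/subsetP => -[k l]; rewrite !inE /= => /andP[kl].
      rewrite kl; have [ki|ki] := eqVneq k i.
        rewrite ki eq_sym in kl *; rewrite dot_shearl //.
        by apply: contraNneq => e; rewrite e (zero l kl e) mulr0 subr0.
      have [li|li] := eqVneq l i.
        rewrite li dotC dot_shearl // (dotC dot (v k)).
        by apply: contraNneq => e; rewrite e (zero k ki e) mulr0 subr0.
      by rewrite /shear (negPf ki) (negPf li).
    exists (i, k0); rewrite !inE /= eq_sym k0i //= dot_shearl //.
    by rewrite divfK // subrr eqxx.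
  move=> k l; have [->|ki] := eqVneq k i.
    by have [->|li] := eqVneq l i; [apply: dot_ge0 | rewrite dot_shearl // cg].
  have [->|li] := eqVneq l i; first by rewrite dotC dot_shearl // cg.
  by rewrite /shear (negPf ki) (negPf li).
(* From here on no edge admits a shear. *)
have next i j : i != j -> dot (v i) (v j) != 0 -> exists k,
    [/\ k != i, dot (v i) (v k) = 0 & dot (v j) (v k) != 0].
  move=> ij gij; have := H (i, j); rewrite /= ij gij /= => /negbT.
  rewrite negb_forall => /existsP[k]; rewrite !negb_imply => /and3P[ki /eqP ik jk].
  by exists k.
case: (pickP (mem (edges v))) => [[i j]|none]; last first.
  apply: orthogonal_embeddable => k l kl; have := none (k, l).
  by rewrite /= inE /= kl => /negbFE/eqP.
rewrite /= inE => /andP[ij gij].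
have [k [ki gik gjk]] := next i j ij gij.
have [l [lj gjl gil]] : exists l,
    [/\ l != j, dot (v j) (v l) = 0 & dot (v i) (v l) != 0].
  by apply: next; [rewrite eq_sym | rewrite dotC].
have kj : k != j by apply: contraNneq gij => <-; rewrite gik.
have li : l != i by apply: contraNneq gij => <-; rewrite dotC gjl.
have kl : k != l by apply: contraNneq gil => <-; rewrite gik.
have us : uniq [:: i; j; k; l].
  by rewrite /= !inE !negb_or ij !(eq_sym i) !(eq_sym j) ki li kj lj kl.
(* Apply [next] to the edge from i to l: the vertex found is not adjacent to i, unlike j and l, so
   it is k, and the cycle closes. *)
have glk : dot (v l) (v k) != 0.
  have [m [mi gim glm]] := next i l ltac:(by rewrite eq_sym) gil.
  case: (ord4_cover m us) => mE; rewrite mE in mi gim glm => //.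
  - by rewrite eqxx in mi.
  - by rewrite gim eqxx in gij.
  - by rewrite gim eqxx in gil.
apply: (cycle_embeddable us) => //; try exact: gt0.
  by apply: gt0; rewrite dotC.
by apply: gt0; rewrite dotC.
Qed.

(** * Passage to positive semidefinite matrices *)

Lemma psdmx_diag (C : numClosedFieldType) (d : nat) (D : 'rV[C]_d) :
  (forall j, 0 <= D 0 j) -> psdmx (diag_mx D).
Proof.
move=> D0; split=> [|x].
  apply/is_hermitianmxP; rewrite expr0 scale1r; apply/matrixP => i j.
  rewrite !mxE [j == i]eq_sym; case: eqVneq => [->|_].
    by rewrite !mulr1n; apply/esym/conj_Creal/ger0_real.
  by rewrite !mulr0n; apply/esym/conjC0.
(* The quadratic form is the sum of the D_j |x_j|^2. *)
rewrite -mulmxA mul_diag_mx mxE sumr_ge0 // => j _; rewrite !mxE.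
by rewrite mulrCA mulr_ge0 // mulrC mul_conjC_ge0.
Qed.

Theorem mainTheorem1 (R : realType) (E : vectType R)
    (dot : {dot E for (@idfun R)}) (n : nat) (hn : (n <= 4)%N)
    (v : 'I_n -> E) (hv : forall k l : 'I_n, 0 <= dot (v k) (v l)) :
  exists A : 'I_n -> 'M[R[i]]_4,
    (forall k : 'I_n, psdmx (A k)) /\
    (forall k l : 'I_n, 4%:R^-1 * \tr (A k *m A l) = (dot (v k) (v l))%:C).
Proof.
(* Padding with zero vectors reduces to n = 4 and keeps all products nonnegative. *)
pose v4 (i : 'I_4) : E := if insub (i : nat) is Some k then v k else 0.
have v4E k : v4 (widen_ord hn k) = v k.
  by rewrite /v4 insubT //= => ltk; congr v; apply: val_inj.
have [k l|B [B0 BE]] := @acute_embeddable4 R E dot v4.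
  rewrite /v4; case: insubP => [p _ _|_]; last by rewrite linear0l.
  by case: insubP => [q _ _|_]; rewrite ?linear0r.
(* The two factors 2 cancel the 1/4 in front of the trace. *)
exists (fun k => diag_mx (map_mx (fun x => (2 * x)%:C) (B (widen_ord hn k)))).
split=> [k|k l].
  apply: psdmx_diag => j; rewrite mxE lecE /= eqxx /=.
  by rewrite mulr_ge0.
rewrite mulmx_diag mxtrace_diag -!v4E BE rmorph_sum mulr_sumr.
apply: eq_bigr => j _; rewrite !mxE !rmorphM /= rmorph_nat.
by field.
Qed.
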